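(* Let $\mathbf W=(W,\le,P)$ be a preorder forest $P$-frame and let $\mathbf D(\mathbf W)$ be its downset algebra. Then the operation $x\cdot y=(\mathsf p x\wedge y)\vee(x\wedge\mathsf p y)$ is associative in $\mathbf D(\mathbf W)$.
   Context: A $P$-frame is a structure $(W,\le,P)$ where $(W,\le)$ is a poset and $P\subseteq W^2$ is a weakening relation: $u\le x$, $xPy$, $y\le v$ imply $uPv$. A preorder forest $P$-frame is a $P$-frame in which $P$ is a preorder (reflexive and transitive) and which satisfies, for all $x,y,z\in W$: (Pforest) $xPy$ and $xPz$ imply ($x\le y$ or $x\le z$ or $yPz$ or $zPy$). The downset algebra $\mathbf D(\mathbf W)$ is the lattice of all downsets of $(W,\le)$ (subsets $X$ with $y\le x\in X\Rightarrow y\in X$), with $\wedge=\cap$, $\vee=\cup$, together with the unary operation $\mathsf p(Y)=\{x\in W\mid\exists y(xPy\text{ and }y\in Y)\}$. *)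

(* Defs.v *)
From HB Require Import structures.
From mathcomp Require Import all_boot all_order.
From mathcomp Require Import boolp classical_sets.
From Corelib Require Import RelationClasses.

Set Implicit Arguments.
Unset Strict Implicit.
Unset Printing Implicit Defensive.

Import Order.TTheory.
Local Open Scope classical_set_scope.
Local Open Scope order_scope.

Record pframe (d : Order.disp_t) := PFrame {
  pframe_sort :> porderType d;
  pframe_rel : pframe_sort -> pframe_sort -> Prop;
  pframe_weakening : forall u x y v : pframe_sort,
    u <= x -> pframe_rel x y -> y <= v -> pframe_rel u v
}.

Record preorder_forest (d : Order.disp_t) (W : pframe d) : Prop :=
  PreorderForest {
    preorder_forest_preorder : PreOrder (@pframe_rel d W);
    preorder_forest_Pforest : forall x y z : W,
      pframe_rel x y -> pframe_rel x z ->
      x <= y \/ x <= z \/ pframe_rel y z \/ pframe_rel z y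
  }.

Definition is_downset (d : Order.disp_t) (T : porderType d) (X : set T) : Prop :=
  forall x y : T, y <= x -> X x -> X y.

(* The carrier of the downset algebra.  It is indexed by the frame rather than
   by the underlying poset because the operation [p] depends on the relation. *)
Record downset (d : Order.disp_t) (W : pframe d) := Downset {
  downset_set :> set W;
  downset_closed : is_downset downset_set
}.

Fact downset_display : Order.disp_t. Proof. exact: Order.Disp tt tt. Qed.

Section DownsetAlgebra.
Variables (d : Order.disp_t) (W : pframe d).
Implicit Types X Y Z : downset W.

Lemma downset_inj X Y : downset_set X = downset_set Y -> X = Y.
Proof.
case: X Y => [X hX] [Y hY] /= eXY; rewrite -{}eXY in hY *.
by congr Downset; exact: Prop_irrelevance.
Qed.

Lemma is_downset_setI X Y : is_downset (X `&` Y)%classic.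
Proof. by move=> x y yx [Xx Yx]; split; exact: downset_closed yx _. Qed.

Lemma is_downset_setU X Y : is_downset (X `|` Y)%classic.
Proof.
by move=> x y yx [Xx|Yx]; [left|right]; exact: downset_closed yx _.
Qed.

Lemma is_downset_p Y :
  is_downset [set x : W | exists y : W, pframe_rel x y /\ downset_set Y y].
Proof.
move=> x u ux [y [xy Yy]]; exists y; split=> //.
exact: pframe_weakening ux xy (lexx y).
Qed.

Definition downset_meet X Y : downset W := Downset (@is_downset_setI X Y).
Definition downset_join X Y : downset W := Downset (@is_downset_setU X Y).
Definition downset_p Y : downset W := Downset (@is_downset_p Y).

Definition downset_le X Y : bool := `[< downset_set X `<=` downset_set Y >].

HB.instance Definition _ := gen_eqMixin (downset W).
HB.instance Definition _ := gen_choiceMixin (downset W).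

Definition downset_lt X Y : bool := (Y != X) && downset_le X Y.

Fact downset_le_def X Y : downset_le X Y = (downset_meet X Y == X).
Proof.
apply/asboolP/eqP => [XY|<- x []//].
by apply: downset_inj; apply/setIidPl.
Qed.

Fact downset_lt_def X Y : downset_lt X Y = (Y != X) && downset_le X Y.
Proof. by []. Qed.

Fact downset_meetC : commutative downset_meet.
Proof. by move=> X Y; apply: downset_inj; exact: setIC. Qed.
Fact downset_joinC : commutative downset_join.
Proof. by move=> X Y; apply: downset_inj; exact: setUC. Qed.
Fact downset_meetA : associative downset_meet.
Proof. by move=> X Y Z; apply: downset_inj; exact: setIA. Qed.
Fact downset_joinA : associative downset_join.
Proof. by move=> X Y Z; apply: downset_inj; exact: setUA. Qed.
Fact downset_joinKI Y X : downset_meet X (downset_join X Y) = X.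
Proof. by apply: downset_inj => /=; rewrite setUC setKU. Qed.
Fact downset_meetKU Y X : downset_join X (downset_meet X Y) = X.
Proof. by apply: downset_inj => /=; rewrite setIC setKI. Qed.
Fact downset_meetUl : left_distributive downset_meet downset_join.
Proof. by move=> X Y Z; apply: downset_inj; exact: setIUl. Qed.
Fact downset_meetxx : idempotent_op downset_meet.
Proof. by move=> X; apply: downset_inj; exact: setIid. Qed.

HB.instance Definition _ :=
  Order.isMeetJoinDistrLattice.Build downset_display (downset W)
    downset_le_def downset_lt_def downset_meetC downset_joinC downset_meetA
    downset_joinA downset_joinKI downset_meetKU downset_meetUl downset_meetxx.

Lemma downset_leP X Y : reflect (downset_set X `<=` downset_set Y) (X <= Y).
Proof. exact: asboolP. Qed.

Lemma downset_meetE X Y : downset_set (X `&` Y)%O = (X `&` Y)%classic.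
Proof. by []. Qed.

Lemma downset_joinE X Y : downset_set (X `|` Y)%O = (X `|` Y)%classic.
Proof. by []. Qed.

Definition downset_mul X Y : downset W :=
  ((downset_p X `&` Y) `|` (X `&` downset_p Y))%O.

End DownsetAlgebra.

(* Main.v *)
Require Import Defs.
From mathcomp Require Import all_boot all_order.
From mathcomp Require Import classical_sets.

(** Since the product is commutative, it suffices to show
    [X (Y Z) <= (X Y) Z].  The only case that uses (Pforest) is a point [w] of
    [Z] with [P]-successors [a] in [X] and [b] in [Y]: each of the four
    alternatives puts [w], [a] or [b] in [X Y], so [w] is in [p (X Y)]. *)

Lemma downset_mulC (d : Order.disp_t) (W : pframe d) :
  commutative (@downset_mul d W).
Proof.
move=> X Y; apply: downset_inj; apply/seteqP.
by split=> w [[? ?]|[? ?]]; [right|left|right|left].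
Qed.

Lemma downset_mulA_subset (d : Order.disp_t) (W : pframe d)
    (hW : preorder_forest W) (X Y Z : downset W) :
  (downset_mul X (downset_mul Y Z) `<=` downset_mul (downset_mul X Y) Z)%classic.
Proof.
case: hW => -[Prefl Ptrans] Pforest.
move=> w [[[a [wa Xa]] [[[b [wb Yb]] Zw]|[Yw pZw]]]|[Xw [c [wc YZc]]]].
- left; split=> //.
  have [wlea|[wleb|[ab|ba]]] := Pforest _ _ _ wa wb.
  (* Downward closure moves [w] into [X] here, into [Y] in the next case; reflexivity then makes [w]
     its own successor in [X Y]. *)
  + exists w; split; first exact: Prefl.
    by right; split; [exact: downset_closed wlea Xa|exists b].
  + exists w; split; first exact: Prefl.
    by left; split; [exists a|exact: downset_closed wleb Yb].
  + by exists a; split=> //; right; split=> //; exists b.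
  + by exists b; split=> //; left; split=> //; exists a.
- by right; split=> //; left; split=> //; exists a.
(* Transitivity through [c] makes [b], respectively [e], a successor of [w]. *)
- right; case: YZc => [[[b [cb Yb]] Zc]|[Yc [e [ce Ze]]]].
  + split; last by exists c.
    by right; split=> //; exists b; split=> //; exact: Ptrans wc cb.
  + split; last by exists e; split=> //; exact: Ptrans wc ce.
    by right; split=> //; exists c.
Qed.

Theorem theorem4p9 (d : Order.disp_t) (W : pframe d) (hW : preorder_forest W) :
  associative (@downset_mul d W).
Proof.
move=> X Y Z; apply: downset_inj; apply/seteqP; split.
  exact: downset_mulA_subset.
(* Commutativity turns the converse inclusion into [Z (Y X) <= (Z Y) X], the one already proved with
   [X] and [Z] swapped. *)
rewrite (downset_mulC _ _ (downset_mul X Y) Z) (downset_mulC _ _ X Y).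
rewrite (downset_mulC _ _ X (downset_mul Y Z)) (downset_mulC _ _ Y Z).
exact: downset_mulA_subset.
Qed.
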